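(* Let $V$ be a finite nonempty set with $|V|=n+1$, let $F=(V_0,\dots,V_{n-k})$ be a flag on $V$, and let $\rho_0,\dots,\rho_{n-k}$ be positive numbers. Consider an ensemble of $n+1-k$ independent Poisson processes, where the $j$th process has rate $\rho_j$ ($0\le j\le n-k$). Let $t_j$ be the arrival time of the $|V_j|$th particle of the $j$th Poisson process. Then $p_F(\rho_0,\dots,\rho_{n-k})$ is the probability that $$t_0\le t_1\le\dots\le t_{n-k}.$$
   Context: A flag on $V$ is an ordered partition $F=(V_0,\dots,V_{n-k})$ of $V$ into nonempty sets. $T=T_V=\{(\lambda_i)_{i\in V}\in\mathbb{R}_{\ge0}^V:\sum_i\lambda_i=1\}$. $R=\{(\rho_0,\dots,\rho_{n-k})\in\mathbb{R}_{\ge0}^{n-k+1}:\sum_j\rho_j=1\}$, $\Theta=\{(\theta_i)_{i\in V}\in\mathbb{R}_{\ge0}^V:\sum_{i\in V_j}\theta_i=1\ \forall j\}$, and $\Phi:R\times\Theta\to T$ is given by $\lambda_i=\rho_j\theta_i$ for $i\in V_j$. For $\boldsymbol\rho$ in the interior of $R$ (all $\rho_j>0$), $$R_{\boldsymbol\rho}=\Big\{(r_0,\dots,r_{n-k})\in R:\tfrac{r_{j-1}}{\rho_{j-1}}\le\tfrac{r_j}{\rho_j}\text{ for all }1\le j\le n-k\Big\},$$ and $p_F(\boldsymbol\rho)$ is the relative volume of the subset $\Phi(R_{\boldsymbol\rho}\times\Theta)$ of $T$ (its $n$-dimensional volume divided by that of $T$). The function $p_F$ is extended to all positive $(\rho_0,\dots,\rho_{n-k})$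 (not necessarily summing to one) as the unique extension invariant under dilation: $p_F(c\boldsymbol\rho)=p_F(\boldsymbol\rho)$ for $c>0$. *)

(* Defs.v *)
From HB Require Import structures.
From mathcomp Require Import all_boot all_order all_algebra.
From mathcomp Require Import all_classical all_reals all_analysis.
Import Order.TTheory GRing.Theory Num.Theory.
Import numFieldNormedType.Exports.

Set Implicit Arguments.
Unset Strict Implicit.
Unset Printing Implicit Defensive.

Local Open Scope classical_set_scope.
Local Open Scope ring_scope.

Section Simplex.
Context {R : realType}.

Definition simplex (I : finType) : set (I -> R) :=
  [set l | (forall i, 0 <= l i) /\ \sum_i l i = 1].

(* Lebesgue measure on R^n as the n-fold product of [lebesgue_measure] on R,
   by the same formula as [product_measure1]: integrate the measure of the
   sections. As for [product_measure1], only the value on Borel sets is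
   meaningful. *)
Fixpoint lebesgue_measure_n (n : nat) : set (n.-tuple R) -> \bar R :=
  match n with
  | 0 => fun A => \d_([tuple]) A
  | n'.+1 => fun A =>
      (\int[lebesgue_measure]_(r in [set: R])
         lebesgue_measure_n [set x : n'.-tuple R | A [tuple of (r : R) :: x]])%E
  end.

(* Affine parametrization of the hyperplane {\sum_i l i = 1} of R^V by R^n,
   n = #|V| - 1: the coordinates of rank < n in the enumeration of V are those
   of x, and the remaining one (the default value of [nth]) is
   1 - \sum_i x_i. *)
Definition hyperplane_chart (V : finType) (x : #|V|.-1.-tuple R) : V -> R :=
  fun v => nth (1 - \sum_(y <- x) y) x (enum_rank v).

(* n-dimensional volume of a subset of that hyperplane, n = #|V| - 1: the
   Gram matrix of the linear part of the chart is the identity plus the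
   all-ones matrix, whose determinant is n + 1 = #|V|. *)
Definition hyperplane_volume (V : finType) (A : set (V -> R)) : \bar R :=
  ((Num.sqrt #|V|%:R)%:E *
     lebesgue_measure_n (@hyperplane_chart V @^-1` A))%E.

Definition relative_volume (V : finType) (A : set (V -> R)) : R :=
  fine (hyperplane_volume A) / fine (hyperplane_volume (@simplex V)).

End Simplex.

Section Flag.
Context {R : realType} {V : finType} {m : nat}.

Definition is_flag (F : 'I_m.+1 -> {set V}) : Prop :=
  (forall j, exists v, v \in F j) /\ (forall v, exists! j, v \in F j).

Variable F : 'I_m.+1 -> {set V}.

Definition Theta : set (V -> R) :=
  [set theta | (forall v, 0 <= theta v) /\
               forall j, \sum_(v in F j) theta v = 1].

(* When F is a flag, exactly one j contributes to the sum. *)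
Definition Phi (r : 'I_m.+1 -> R) (theta : V -> R) : V -> R :=
  fun v => \sum_(j | v \in F j) r j * theta v.

Definition R_rho (rho : 'I_m.+1 -> R) : set ('I_m.+1 -> R) :=
  [set r | simplex r /\
           forall i j : 'I_m.+1, j = i.+1 :> nat -> r i / rho i <= r j / rho j].

(* p_F on the interior of the simplex R *)
Definition p_flag_simplex (rho : 'I_m.+1 -> R) : R :=
  relative_volume [set Phi r theta | r in R_rho rho & theta in Theta].

Definition p_flag (rho : 'I_m.+1 -> R) : R :=
  p_flag_simplex (fun j => rho j / \sum_i rho i).

Lemma p_flagE (rho : 'I_m.+1 -> R) :
  \sum_i rho i = 1 -> p_flag rho = p_flag_simplex rho.
Proof.
by move=> rho1; congr p_flag_simplex; apply/funext => j; rewrite rho1 divr1.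
Qed.

Lemma p_flag_dilation (c : R) (rho : 'I_m.+1 -> R) :
  0 < c -> p_flag (fun j => c * rho j) = p_flag rho.
Proof.
move=> c0; congr p_flag_simplex; apply/funext => j.
by rewrite -mulr_sumr -mulf_div divff ?mul1r// gt_eqF.
Qed.

End Flag.

Section Poisson.
Context {d : measure_display} {Omega : measurableType d} {R : realType}.
Variable P : probability Omega R.

Definition mutually_independent (I : finType) (S : I -> set (set Omega)) :
    Prop :=
  forall (J : {set I}) (E : I -> set Omega),
    (forall i, i \in J -> S i (E i)) ->
    fine (P (\bigcap_(i in [set` J]) E i)) = \prod_(i in J) fine (P (E i)).

(* sigma-algebra generated by a random variable *)
Definition sigma_of d' (T : measurableType d') (X : Omega -> T) :
    set (set Omega) :=
  preimage_set_system setT X measurable.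

Definition increment (N : R -> {RV P >-> nat}) (s t : R) : Omega -> nat :=
  fun w => (N t w - N s w)%N.

(* N t is the number of arrivals up to time t; its values at times t < 0 are
   ignored. *)
Record poisson_process (rate : R) (N : R -> {RV P >-> nat}) : Prop := {
  poisson_start : forall w, N 0 w = 0%N ;
  poisson_nondecreasing : forall w s t, 0 <= s -> s <= t ->
    (N s w <= N t w)%N ;
  poisson_right_continuous : forall w t, 0 <= t ->
    N s w @[s --> t^'+] --> N t w ;
  poisson_independent_increments : forall (l : nat) (t : nat -> R),
    0 <= t 0%N -> (forall i, t i < t i.+1) ->
    mutually_independent
      (fun i : 'I_l => sigma_of (increment N (t i) (t i.+1))) ;
  poisson_increment_law : forall (s t : R) (k : nat), 0 <= s -> s < t ->
    P (increment N s t @^-1` [set k]) =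
      (poisson_pmf (rate * (t - s)) k)%:E
}.

Definition independent_processes (I : finType)
    (N : I -> R -> {RV P >-> nat}) : Prop :=
  mutually_independent (fun i =>
    <<s \bigcup_(t in [set t : R | 0 <= t]) sigma_of (N i t) >>).

(* arrival time of the a-th particle; +oo if it never arrives *)
Definition arrival (N : R -> {RV P >-> nat}) (a : nat) (w : Omega) : \bar R :=
  ereal_inf [set t%:E | t in [set t : R | 0 <= t /\ (a <= N t w)%N]].

End Poisson.

(* Main.v *)
From HB Require Import structures.
Require Import Defs.
From mathcomp Require Import all_boot all_order all_algebra.
From mathcomp Require Import all_classical all_reals all_analysis.
From mathcomp Require Import measurable_realfun ring lra.
Import Order.TTheory GRing.Theory Num.Theory.
Import numFieldNormedType.Exports.

(** Let X be a family of independent standard exponential variables indexed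
by V. Two facts about X are compared.

Normalising X to sum one gives a uniform point of the simplex T. Hence, for a
cone C of the positive orthant, the probability that X lies in C is the
relative volume of the trace of C on T. In [iint_exp_cone] this is seen by
taking the total sum s as a new coordinate in place of the last one: the
weight becomes exp (- s), Tonelli's theorem moves the integral over s outside,
and the dilation by s extracts s ^ n. The law of the exponential family on C
is thus the volume of the trace times a constant that depends only on n.
Applying this to C and to the whole orthant, whose probability is one,
eliminates the constant and leaves the quotient of volumes
([exp_measure_cone]).

Write S_j for the sum of X over V_j. The S_j are independent and S_j has the
Gamma law of shape #|V_j| ([iint_below_blocks]); so S_j / rho_j is distributed
as the arrival time t_j, whose distribution function is the upper tail of a
Poisson law ([poisson_tail]). Since the t_j are independent too
([arrivals_joint_law]), the vectors (t_j) and (S_j / rho_j) give the same mass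
to every lower box, hence have the same law ([tuple_measure_unique]).

The probability of t_0 <= ... <= t_(n-k) is therefore that of
S_0 / rho_0 <= ... <= S_(n-k) / rho_(n-k), which is a cone condition on X. Its
trace on T is Phi (R_rho x Theta), because S_j = r_j at the point
Phi (r, theta) ([image_Phi]). *)

Set Implicit Arguments.
Unset Strict Implicit.
Unset Printing Implicit Defensive.

Local Open Scope classical_set_scope.
Local Open Scope ring_scope.

(** * Iterated Lebesgue integrals *)

Section IteratedIntegral.
Context {R : realType}.
Local Notation mu := (@lebesgue_measure R).

Local Open Scope ereal_scope.

(** The functional counterpart of [lebesgue_measure_n]: working with integrals
rather than with sets makes Tonelli's theorem and dilations accessible by
induction on the number of variables. *)
Fixpoint iint n : (n.-tuple R -> \bar R) -> \bar R :=
  match n with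
  | 0 => fun f => f [tuple]
  | n'.+1 => fun f =>
      \int[mu]_(r in [set: R])
        iint (fun x : n'.-tuple R => f [tuple of r :: x])
  end.

Lemma lebesgue_measure_nE n (A : set (n.-tuple R)) :
  lebesgue_measure_n A = iint (fun x => (\1_A x)%:E).
Proof.
elim: n A => [|n IHn] A //=; by apply: eq_integral => r _; rewrite IHn.
Qed.

Lemma eq_iint n (f g : n.-tuple R -> \bar R) : f =1 g -> iint f = iint g.
Proof. by move=> fg; congr iint; apply/funext. Qed.

Lemma iint0 n : iint (fun _ : n.-tuple R => 0) = 0.
Proof. by elim: n => [|n IHn] //=; rewrite integral0_eq. Qed.

Lemma iint_ge0 n (f : n.-tuple R -> \bar R) :
  (forall x, 0 <= f x) -> 0 <= iint f.
Proof.
elim: n f => [|n IHn] f f0 //=.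
by apply: integral_ge0 => r _; apply: IHn.
Qed.

(** The parameter space [T] is arbitrary because the induction absorbs the first
variable of integration into it. *)
Lemma measurable_iint n d (T : measurableType d)
    (f : T * n.-tuple R -> \bar R) :
  measurable_fun setT f -> (forall z, 0 <= f z) ->
  measurable_fun setT (fun t => iint (fun x => f (t, x))).
Proof.
elim: n d T f => [|n IHn] d T f mf f0 /=.
  exact: (measurableT_comp mf (measurable_pair2 _)).
pose g (z : (T * R) * n.-tuple R) :=
  f (z.1.1, [tuple of z.1.2 :: z.2]).
have mg : measurable_fun setT g.
  apply: (measurableT_comp mf); apply/measurable_fun_pairP; split => /=.
    exact: (measurableT_comp measurable_fst measurable_fst).
  apply: measurable_cons => //.
  exact: (measurableT_comp measurable_snd measurable_fst).
pose h (z : T * R) := iint (fun x => g (z, x)).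
have mh : measurable_fun setT h by apply: IHn => // z; exact: f0.
have h0 z : 0 <= h z by apply: iint_ge0 => x; exact: f0.
exact: (@measurable_fun_fubini_tonelli_F _ _ _ _ _ mu h mh h0).
Qed.

Lemma measurable_iint_cons n (f : n.+1.-tuple R -> \bar R) :
  measurable_fun setT f -> (forall z, 0 <= f z) ->
  measurable_fun [set: R]
    (fun r => iint (fun x : n.-tuple R => f [tuple of r :: x])).
Proof.
move=> mf f0.
apply: (@measurable_iint n _ (R)
          (fun z => f [tuple of z.1 :: z.2])) => //.
by apply: (measurableT_comp mf); apply: measurable_cons.
Qed.

Lemma measurable_tuple_cons n (f : n.+1.-tuple R -> \bar R) r :
  measurable_fun setT f ->
  measurable_fun setT (fun x : n.-tuple R => f [tuple of r :: x]).
Proof.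
move=> mf; apply: (measurableT_comp mf).
by apply: measurable_cons => //; exact: measurable_cst.
Qed.

Lemma iintZl n (c : R) (f : n.-tuple R -> \bar R) :
  measurable_fun setT f -> (forall z, 0 <= f z) -> (0 <= c)%R ->
  iint (fun x => c%:E * f x) = c%:E * iint f.
Proof.
elim: n f => [|n IHn] f mf f0 c0 //=.
rewrite -ge0_integralZl_EFin//.
- apply: eq_integral => r _; apply: IHn => //.
  exact: measurable_tuple_cons.
- by move=> r _; apply: iint_ge0.
- exact: measurable_iint_cons.
Qed.

Lemma iint_nneseries n (f : nat -> n.-tuple R -> \bar R) :
  (forall i, measurable_fun setT (f i)) -> (forall i z, 0 <= f i z) ->
  iint (fun x => \sum_(i <oo) f i x) = \sum_(i <oo) iint (f i).
Proof.
elim: n f => [|n IHn] f mf f0 //=.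
rewrite -integral_nneseries//.
- apply: eq_integral => r _; rewrite -IHn// => i.
  exact: measurable_tuple_cons.
- by move=> i; exact: measurable_iint_cons.
- by move=> i r _; apply: iint_ge0.
Qed.

Lemma iint_tonelli n (f : n.-tuple R * R -> \bar R) :
  measurable_fun setT f -> (forall z, 0 <= f z) ->
  iint (fun x => \int[mu]_s f (x, s)) = \int[mu]_s iint (fun x => f (x, s)).
Proof.
elim: n f => [|n IHn] f mf f0 //=.
pose g (z : (R * R) * n.-tuple R) :=
  f ([tuple of z.1.1 :: z.2], z.1.2).
have mg : measurable_fun setT g.
  apply: (measurableT_comp mf); apply/measurable_fun_pairP; split => /=.
    apply: measurable_cons => //.
    exact: (measurableT_comp measurable_fst measurable_fst).
  exact: (measurableT_comp measurable_snd measurable_fst).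
pose h (z : R * R) := iint (fun x => g (z, x)).
have mh : measurable_fun setT h by apply: measurable_iint => // z; exact: f0.
have h0 z : 0 <= h z by apply: iint_ge0 => x; exact: f0.
transitivity (\int[mu]_r \int[mu]_s h (r, s)).
  apply: eq_integral => r _.
  apply: (IHn (fun z => f ([tuple of r :: z.1], z.2))) => //.
  apply: (measurableT_comp mf); apply/measurable_fun_pairP; split => /=.
    by apply: measurable_cons => //; exact: measurable_cst.
  exact: measurable_snd.
exact: (fubini_tonelli (m1 := mu) (m2 := mu) h mh h0).
Qed.

(** The definition isolates the first variable; isolating the last one instead
matches [hyperplane_chart], where the last coordinate is the one determined by
the others. *)
Lemma iint_rcons n (f : n.+1.-tuple R -> \bar R) :
  iint f = iint (fun x : n.-tuple R => \int[mu]_r f [tuple of rcons x r]).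
Proof.
elim: n f => [|n IHn] f.
  by rewrite /=; apply: eq_integral => r _; congr f; apply: val_inj.
rewrite [LHS]/=; apply: eq_integral => r _.
rewrite -[LHS]/(iint (fun x : n.+1.-tuple R => f [tuple of r :: x])) IHn.
apply: eq_iint => x; apply: eq_integral => s _; congr f; exact: val_inj.
Qed.

End IteratedIntegral.

(** * Exponential weight of a cone *)

Section Image.
Context d d' (T1 : measurableType d) (T2 : measurableType d') (R : realType).
Variables (m : {measure set T1 -> \bar R}) (f : T1 -> T2).
Hypothesis mf : measurable_fun [set: T1] f.

(** The proof of measurability is an argument so that the term determines its
measure structure. *)
Definition image_measure of measurable_fun [set: T1] f :
    set T2 -> \bar R :=
  pushforward m f.

HB.instance Definition _ := Measure.copy (image_measure mf)
  (measure_function_pushforward__canonical__measure_function_Measure m mf).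
End Image.

Section Cone.
Context {R : realType}.
Local Notation mu := (@lebesgue_measure R).
Local Open Scope ereal_scope.

Let aff (a b : R) : R -> measurableTypeR R := fun r => (a * r + b)%R.

Let measurable_aff a b : measurable_fun [set: measurableTypeR R] (aff a b).
Proof. by apply: measurable_funD => //; exact: measurable_funM. Qed.

(** The image of Lebesgue measure under the affine map, multiplied by [a], gives
every interval its length, hence is Lebesgue measure. *)
Lemma integral_affine (a b : R) (f : R -> \bar R) : (0 < a)%R ->
  measurable_fun setT f -> (forall r, 0 <= f r) ->
  \int[mu]_r f r = a%:E * \int[mu]_r f (a * r + b)%R.
Proof.
move=> a0 mf f0; have a0' : (0 <= a)%R by exact: ltW.
pose nu := mscale (NngNum a0') (image_measure mu (measurable_aff a b)).
have muE A : measurable A -> mu A = nu A.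
  apply: lebesgue_measure_unique => _ [[x y]] _ <-.
  change (mu `]x, y]%classic = a%:E * mu (aff a b @^-1` `]x, y]%classic)).
  have -> : (aff a b @^-1` `]x, y] = `](x - b) / a, (y - b) / a])%classic%R.
    by apply/seteqP; split => r /=; rewrite /aff !in_itv/=
      ltr_pdivrMr ?ler_pdivlMr// ltrBlDr lerBrDr mulrC.
  rewrite !lebesgue_measure_itv/= !lte_fin ltr_pM2r ?invr_gt0// ltrD2r.
  case: ifP => _; last by rewrite mule0.
  by rewrite -!EFinB -EFinM; congr EFin; field; exact: lt0r_neq0.
transitivity (\int[nu]_r f r).
  by apply: eq_measure_integral => A mA _; exact: muE.
rewrite ge0_integral_mscale//; congr (_ * _).
by rewrite ge0_integral_pushforward.
Qed.

Definition scale_tuple n (c : R) (x : n.-tuple R) : n.-tuple R :=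
  [tuple of map ( *%R c) x].

Lemma measurable_scale_tuple n c :
  measurable_fun [set: n.-tuple R] (@scale_tuple n c).
Proof.
apply/measurable_fun_tnthP => i.
rewrite (_ : _ \o _ = fun x => (c * tnth x i)%R); last first.
  by apply/funext => x /=; rewrite tnth_map.
by apply: measurable_funM => //; exact: measurable_tnth.
Qed.

Lemma iint_dilate n (c : R) (f : n.-tuple R -> \bar R) : (0 < c)%R ->
  measurable_fun setT f -> (forall x, 0 <= f x) ->
  iint f = (c ^+ n)%:E * iint (fun x => f (scale_tuple c x)).
Proof.
move=> c0; elim: n f => [|n IHn] f mf f0.
  by rewrite expr0 mul1e /=; congr f; exact: val_inj.
rewrite [LHS]/= (integral_affine 0 c0); last 2 first.
- exact: measurable_iint_cons.
- by move=> r; exact: iint_ge0.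
rewrite exprS EFinM -muleA; congr (_ * _).
rewrite [X in _ * X]/= -ge0_integralZl_EFin//; last first.
- by rewrite exprn_ge0// ltW.
- apply: (measurable_iint_cons (f := fun x => f (scale_tuple c x))) => //.
  by apply: (measurableT_comp mf); exact: measurable_scale_tuple.
- by move=> r _; exact: iint_ge0.
apply: eq_integral => r _; rewrite IHn//; last exact: measurable_tuple_cons.
congr (_ * _); apply: eq_iint => x; congr f; apply: val_inj => /=.
by rewrite addr0.
Qed.

(** Joint density of independent standard exponential variables. *)
Definition exp_weight n (x : n.-tuple R) : R :=
  (\prod_(i < n) exponential_pdf 1 (tnth x i))%R.

Lemma exp_weight_ge0 n (x : n.-tuple R) : (0 <= exp_weight x)%R.
Proof. by apply: prodr_ge0 => i _; exact: exponential_pdf_ge0. Qed.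

Lemma measurable_exp_weight n : measurable_fun setT (@exp_weight n).
Proof.
apply: measurable_prod => i _.
apply: measurableT_comp; last exact: measurable_tnth.
exact: measurable_exponential_pdf.
Qed.

Lemma exp_weight_orthant n (x : n.-tuple R) : (forall i, 0 <= tnth x i)%R ->
  exp_weight x = expR (- \sum_(i < n) tnth x i).
Proof.
move=> x0; rewrite -sumrN expR_sum; apply: eq_bigr => i _.
by rewrite exponential_pdfE// mul1r mulN1r.
Qed.

(** The point of the hyperplane {sum = s} with first coordinates [y]. For s = 1
this is [hyperplane_chart] read in the enumeration order of the index set. *)
Definition complete_sum n (y : n.-tuple R) (s : R) : n.+1.-tuple R :=
  [tuple of rcons y (s - \sum_(i < n) tnth y i)%R].

Lemma tnth_complete_sum_lift n (y : n.-tuple R) s (i : 'I_n) :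
  tnth (complete_sum y s) (widen_ord (leqnSn n) i) = tnth y i.
Proof.
by rewrite !(tnth_nth 0%R) /= nth_rcons size_tuple ltn_ord.
Qed.

Lemma tnth_complete_sum_max n (y : n.-tuple R) s :
  tnth (complete_sum y s) ord_max = (s - \sum_(i < n) tnth y i)%R.
Proof. by rewrite (tnth_nth 0%R) /= nth_rcons size_tuple ltnn eqxx. Qed.

Lemma sum_complete_sum n (y : n.-tuple R) s :
  (\sum_(i < n.+1) tnth (complete_sum y s) i)%R = s.
Proof.
rewrite big_ord_recr/= tnth_complete_sum_max.
under eq_bigr do rewrite tnth_complete_sum_lift.
by rewrite addrC subrK.
Qed.

Lemma scale_complete_sum n (y : n.-tuple R) c s :
  scale_tuple c (complete_sum y s) = complete_sum (scale_tuple c y) (c * s).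
Proof.
apply: val_inj => /=; rewrite map_rcons; congr rcons.
rewrite mulrBr; congr (_ - _)%R; rewrite mulr_sumr.
by apply: eq_bigr => i _; rewrite tnth_map.
Qed.

Lemma measurable_complete_sum n :
  measurable_fun setT (fun z : n.-tuple R * R => complete_sum z.1 z.2).
Proof.
apply/measurable_fun_tnthP => i.
have [ltin|leni] := ltnP i n.
- have -> : i = widen_ord (leqnSn n) (Ordinal ltin) by exact: val_inj.
  rewrite (_ : _ \o _ = fun z => tnth z.1 (Ordinal ltin)); last first.
    by apply/funext => z; exact: tnth_complete_sum_lift.
  exact: (measurableT_comp (measurable_tnth _) measurable_fst).
- have -> : i = ord_max.
    by apply/val_inj/eqP; rewrite eqn_leq leni -ltnS ltn_ord.
  rewrite (_ : _ \o _ = fun z => z.2 - \sum_(i < n) tnth z.1 i)%R; last first.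
    by apply/funext => z; exact: tnth_complete_sum_max.
  apply: measurable_funB => //; apply: measurable_sum => k.
  exact: (measurableT_comp (measurable_tnth _) measurable_fst).
Qed.

(** Gamma (n + 1); a common factor of the two measures compared in
[exp_measure_cone]. *)
Definition gamma_mass (n : nat) : \bar R :=
  \int[mu]_(s in `]0%R, +oo[) (expR (- s) * s ^+ n)%:E.

(** Coordinates are changed from (y, r) to (y, s) with s the total sum. The
slice of [C] at height s is s times its slice at height 1, so its volume is
s ^ n times that of the latter. *)
Lemma iint_exp_cone n (C : set (n.+1.-tuple R)) : measurable C ->
  (forall x, C x -> forall i, (0 <= tnth x i)%R) ->
  (forall c x, (0 < c)%R -> C x -> C (scale_tuple c x)) ->
  iint (fun x => (\1_C x * exp_weight x)%:E) =
  gamma_mass n * lebesgue_measure_n [set y | C (complete_sum y 1)].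
Proof.
move=> mC C0 Cc.
pose f (x : n.+1.-tuple R) :=
  (\1_C x * expR (- \sum_(i < n.+1) tnth x i))%:E.
have -> : iint (fun x => (\1_C x * exp_weight x)%:E) = iint f.
  apply: eq_iint => x; rewrite /f indicE.
  have [/set_mem Cx|] := boolP (x \in C).
    by rewrite exp_weight_orthant//; exact: C0.
  by rewrite !mul0r.
pose g (z : n.-tuple R * R) := (\1_C (complete_sum z.1 z.2) * expR (- z.2))%:E.
have mf : measurable_fun setT f.
  apply/measurable_EFinP; apply: measurable_funM; first exact: measurable_indic.
  apply: measurableT_comp => //; apply: measurableT_comp => //.
  by apply: measurable_sum => i; exact: measurable_tnth.
have mg : measurable_fun setT g.
  apply/measurable_EFinP; apply: measurable_funM.
    by apply: measurableT_comp (@measurable_complete_sum n).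
  by apply: measurableT_comp => //; apply: measurableT_comp.
have f0 x : 0 <= f x by rewrite lee_fin mulr_ge0// expR_ge0.
have g0 z : 0 <= g z by rewrite lee_fin mulr_ge0// expR_ge0.
(* For fixed y, the map r = s - sum y is a translation. *)
transitivity (iint (fun y : n.-tuple R => \int[mu]_s g (y, s))).
  rewrite iint_rcons; apply: eq_iint => y.
  rewrite (integral_affine (- \sum_(i < n) tnth y i)%R (@ltr01 R))//;
    last first.
    apply: (measurableT_comp mf).
    rewrite (_ : (fun r => _) =
        fun r => complete_sum y (r + \sum_(i < n) tnth y i)%R).
      pose p r := (y, r + \sum_(i < n) tnth y i)%R.
      have mp : measurable_fun [set: R] p.
        apply/measurable_fun_pairP; split => /=; first exact: measurable_cst.
        exact: measurable_funD.
      exact: (measurableT_comp (@measurable_complete_sum n) mp).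
    by apply/funext => r; rewrite /complete_sum addrK.
  rewrite mul1e; apply: eq_integral => s _; rewrite mul1r.
  by rewrite -/(complete_sum y s) /f sum_complete_sum.
rewrite iint_tonelli//.
pose h s := iint (fun y => g (y, s)).
have mh : measurable_fun [set: R] h.
  apply: (measurable_iint (f := fun z : R * n.-tuple R => g (z.2, z.1))) => //.
  have mp : measurable_fun setT (fun z : R * n.-tuple R => (z.2, z.1)).
    by apply/measurable_fun_pairP; split;
      [exact: measurable_snd|exact: measurable_fst].
  exact: (measurableT_comp mg mp).
have h0 s : 0 <= h s by exact: iint_ge0.
rewrite -/h.
(* A slice of negative height is empty since C lies in the orthant. *)
transitivity (\int[mu]_(s in `[0%R, +oo[) h s).
  rewrite [RHS]integral_mkcond; apply: eq_integral => s _.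
  rewrite patchE; case: ifPn => //.
  rewrite notin_setE/= in_itv/= andbT => /negP.
  rewrite -ltNge => s0; rewrite /h -[RHS](iint0 n); apply: eq_iint => y.
  rewrite /g /= indicE memNset ?mul0r// => /C0 ge0.
  have : (0 <= \sum_(i < n.+1) tnth (complete_sum y s) i)%R.
    by apply: sumr_ge0 => i _; exact: ge0.
  by rewrite sum_complete_sum leNgt s0.
(* The slice of height 0 is not a dilate of the unit slice; one height is
   negligible. *)
rewrite -integral_itv_obnd_cbnd//; last exact: measurable_funTS.
rewrite /gamma_mass lebesgue_measure_nE.
rewrite [RHS]muleC -ge0_integralZl//; last 3 first.
- apply/measurable_EFinP; apply: measurable_funM; last exact: exprn_measurable.
  by apply: measurableT_comp => //; exact: measurableT_comp.
- move=> s /=; rewrite in_itv/= andbT => s0.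
  by rewrite lee_fin mulr_ge0 ?expR_ge0// exprn_ge0// ltW.
- by apply: iint_ge0 => y; rewrite lee_fin.
apply: eq_integral => s; rewrite inE/= in_itv/= andbT => s0.
rewrite /h (iint_dilate s0)//; last first.
  have mp : measurable_fun setT (fun y : n.-tuple R => (y, s)).
    by apply/measurable_fun_pairP; split;
      [exact: measurable_id|exact: measurable_cst].
  exact: (measurableT_comp mg mp).
have CsE x : C (scale_tuple s x) = C x.
  apply/propext; split => [Csx|]; last exact: Cc.
  have : C (scale_tuple s^-1 (scale_tuple s x)) by apply: Cc; rewrite ?invr_gt0.
  congr C; apply: val_inj => /=; rewrite -map_comp -[RHS]map_id.
  by apply: eq_map => z /=; rewrite mulKf// gt_eqF.
rewrite [RHS]muleC EFinM (muleC (expR _)%:E) -muleA; congr (_ * _).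
rewrite -iintZl ?expR_ge0//.
- apply: eq_iint => y; rewrite /g/= muleC EFinM; congr (_%:E * _).
  rewrite !indicE; congr ((_ : bool)%:R); apply/idP/idP; rewrite !inE/=.
    by rewrite -{2}(mulr1 s) -scale_complete_sum CsE.
  by rewrite -{2}(mulr1 s) -scale_complete_sum CsE.
- apply/measurable_EFinP; apply: measurable_indic.
  have mp : measurable_fun setT (fun y : n.-tuple R => (y, 1%R : R)).
    by apply/measurable_fun_pairP; split;
      [exact: measurable_id|exact: measurable_cst].
  rewrite -[X in measurable X]setTI.
  have mq := measurableT_comp (@measurable_complete_sum n) mp.
  exact: (mq measurableT _ mC).
Qed.

End Cone.

(** * Gamma distribution functions *)

Section Gamma.
Context {R : realType}.
Local Notation mu := (@lebesgue_measure R).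

(** Distribution function of the Gamma law of integer shape [a] and rate 1, in
the form of a Poisson tail. Shape 0 is the Dirac mass at 0, which starts the
induction on the shape. *)
Definition gamma_cdf (a : nat) (t : R) : R :=
  if t < 0 then 0 else 1 - \sum_(k < a) t ^+ k / k`!%:R * expR (- t).

Let primitive (a : nat) (t : R) : R -> R := fun r =>
  \sum_(k < a) expR (- t) / k.+1`!%:R * (t - r) ^+ k.+1 - expR (- r).

Let integrand (a : nat) (t : R) : R -> R := fun r =>
  expR (- r) - \sum_(k < a) expR (- t) / k`!%:R * (t - r) ^+ k.

Let is_derive_primitive a t (r : R) :
  is_derive r 1 (primitive a t) (integrand a t r).
Proof.
have dsub : is_derive r (1 : R) (fun s : R => t - s) (-1).
  have := is_deriveB (is_derive_cst t r 1) (is_derive_id r 1).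
  by rewrite sub0r.
have dpow (k : 'I_a) : is_derive r (1 : R)
    (fun s : R => expR (- t) / k.+1`!%:R * (t - s) ^+ k.+1)
    (- (expR (- t) / k`!%:R * (t - r) ^+ k)).
  have := is_deriveZ (expR (- t) / k.+1`!%:R) (is_deriveX k.+1 dsub).
  rewrite exprfctE => /is_derive_eq; apply.
  rewrite /GRing.scale/= mulrN1 mulrN; congr (- _).
  rewrite factS natrM mulrA; congr (_ * _); field.
  by rewrite pnatr_eq0 -lt0n fact_gt0 nat1r pnatr_eq0.
have dexp : is_derive r (1 : R) (fun s : R => expR (- s)) (- expR (- r)).
  have dN : is_derive r (1 : R) (fun s : R => - s) (-1).
    exact: is_deriveN.
  have := is_derive1_comp (is_derive_expR (- r)) dN.
  by rewrite mulrN1.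
have := is_deriveB (is_derive_sum dpow) dexp.
have -> : (\sum_(k < a)
    (fun s : R => expR (- t) / k.+1`!%:R * (t - s) ^+ k.+1) -
    (fun s => expR (- s))) = primitive a t.
  by apply/funext => s; congr (_ - _); rewrite fct_sumE.
by move/is_derive_eq; apply; rewrite sumrN opprK addrC.
Qed.

Let continuous_integrand a t : continuous (integrand a t).
Proof.
elim: a => [|a IHa] r.
  have -> : integrand 0 t = expR \o -%R.
    by apply/funext => s; rewrite /integrand big_ord0 subr0.
  apply: continuous_comp; first exact: opp_continuous.
  exact: continuous_expR.
have -> : integrand a.+1 t =
    (fun s => integrand a t s - expR (- t) / a`!%:R * (t - s) ^+ a).
  by apply/funext => s; rewrite /integrand big_ord_recr/= opprD addrA.
apply: cvgB; first exact: IHa.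
apply: cvgMr.
apply: (@continuous_comp _ _ _ (fun s => t - s) (fun s => s ^+ a)).
  by apply: cvgB; [exact: cvg_cst|exact: cvg_id].
exact: exprn_continuous.
Qed.

(** Adding an independent exponential variable raises the shape by one. For
t > 0 the integrand lives on [0, t] and has an explicit primitive, because
exp (- r) * exp (- (t - r)) does not depend on r. *)
Lemma integral_exponential_gamma_cdf (a : nat) (t : R) :
  (\int[mu]_r (exponential_pdf 1 r * gamma_cdf a (t - r))%:E =
   (gamma_cdf a.+1 t)%:E)%E.
Proof.
have [t0|t0|->] := ltgtP t 0.
- rewrite /gamma_cdf t0; apply: integral0_eq => r _; congr EFin.
  have [r0|r0] := ltP r 0; first by rewrite lt0_exponential_pdf// mul0r.
  by rewrite ifT ?mulr0//; lra.
- transitivity (\int[mu]_(r in `[0%R, t]) (integrand a t r)%:E)%E.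
    rewrite [RHS]integral_mkcond; apply: eq_integral => r _.
    rewrite patchE; case: ifPn => [|]; rewrite ?inE ?notin_setE/= in_itv/=.
      move=> /andP[r0 rt]; congr EFin.
      rewrite exponential_pdfE// /gamma_cdf ifF; last first.
        by apply/negbTE; rewrite -leNgt; lra.
      rewrite mul1r mulN1r mulrBr mulr1 mulr_sumr; congr (_ - _).
      apply: eq_bigr => k _.
      rewrite mulrC -!mulrA -expRD (_ : - (t - r) - r = - t); last by lra.
      by rewrite mulrC mulrAC mulrC.
    move=> /negP; rewrite negb_and -!ltNge => /orP[r0|tr];
      transitivity (0%:E : \bar R) => //; congr EFin.
      by rewrite lt0_exponential_pdf// mul0r.
    by rewrite /gamma_cdf ifT ?mulr0//; lra.
  rewrite (@continuous_FTC2 _ _ (primitive a t))//.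
  + rewrite -EFinB; congr EFin; rewrite /gamma_cdf ltNge (ltW t0)/=.
    rewrite /primitive !subr0 oppr0 expR0 subrr.
    rewrite big1 => [|k _]; last by rewrite expr0n mulr0.
    rewrite big_ord_recl/= expr0 fact0 divr1 mul1r.
    under [in RHS]eq_bigr do rewrite /bump/= add1n mulrC mulrA mulrAC.
    by rewrite sub0r [in RHS]opprD opprB addrCA.
  + by apply: continuous_subspaceT => r; exact: continuous_integrand.
  + have cp r : {for r, continuous (primitive a t)}.
      by apply: differentiable_continuous;
        apply/derivable1_diffP; exact: ex_derive.
    split; first by move=> r _; exact: ex_derive.
      by apply: cvg_at_right_filter; exact: cp.
    by apply: cvg_at_left_filter; exact: cp.
  + by move=> r _; rewrite derive1E; exact: derive_val.
- transitivity (\int[mu]_(r in [set 0%R])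
      (exponential_pdf 1 r * gamma_cdf a (0 - r))%:E)%E.
    rewrite [RHS]integral_mkcond; apply: eq_integral => r _.
    rewrite patchE; case: ifPn => //; rewrite notin_setE/= => /eqP r0.
    transitivity (0%:E : \bar R) => //; congr EFin; have [rlt0|rge0] := ltP r 0.
      by rewrite lt0_exponential_pdf// mul0r.
    by rewrite /gamma_cdf ifT ?mulr0// sub0r oppr_lt0 lt_neqAle eq_sym r0.
  rewrite integral_set1 /gamma_cdf ltxx oppr0 expR0.
  rewrite big_ord_recl/= expr0 fact0 divr1 mulr1 big1 ?addr0 ?subrr// => k _.
  by rewrite /bump/= expr0n/= mul0r mul0r.
Qed.

End Gamma.

(** * The law of independent exponential variables and of its block sums *)

Section ExpMeasure.
Context {R : realType}.
Local Notation mu := (@lebesgue_measure R).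

Lemma gamma_cdf_ge0 a (t : R) : 0 <= gamma_cdf a t.
Proof.
elim: a t => [|a IHa] t.
  by rewrite /gamma_cdf big_ord0 subr0; case: ifP.
rewrite -lee_fin -integral_exponential_gamma_cdf; apply: integral_ge0 => r _.
by rewrite lee_fin mulr_ge0 ?exponential_pdf_ge0.
Qed.

Lemma measurable_gamma_cdf a : measurable_fun setT (@gamma_cdf R a).
Proof.
apply: measurable_fun_if => //; first exact: measurable_fun_ltr.
apply: measurable_funTS; apply: measurable_funB => //.
apply: measurable_sum => k; apply: measurable_funM.
  exact: measurable_funM.
by apply: measurableT_comp.
Qed.

Lemma exp_weight_cons n r (x : n.-tuple R) :
  exp_weight [tuple of r :: x] = exponential_pdf 1 r * exp_weight x.
Proof.
rewrite /exp_weight big_ord_recl tnth0; congr (_ * _).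
by apply: eq_bigr => i _; rewrite tnthS.
Qed.

(** Indicator of the event that each block sum is at most its bound. A product
of indicators, unlike the indicator of the event, splits off the block of the
first variable. *)
Definition below_blocks (I : finType) n (c : 'I_n -> I) (b : I -> R)
    (x : n.-tuple R) : R :=
  \prod_(j : I) (\sum_(i < n | c i == j) tnth x i <= b j)%R%:R.

Lemma measurable_below_blocks (I : finType) n (c : 'I_n -> I) (b : I -> R) :
  measurable_fun setT (below_blocks c b).
Proof.
apply: measurable_prod => j _.
apply: (@measurableT_comp _ _ _ _ _ _ (fun b : bool => b%:R : R)) => //.
apply: measurable_fun_ler => //.
under eq_fun do rewrite big_mkcond.
by apply: measurable_sum => i; case: (c i == j) => //; exact: measurable_tnth.
Qed.

Lemma below_blocks_ge0 (I : finType) n (c : 'I_n -> I) (b : I -> R) x :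
  0 <= below_blocks c b x.
Proof. exact: prodr_ge0. Qed.

(** Block sums are independent Gamma variables. Integrating out the first
variable r lowers the bound of its own block by r and leaves the other blocks
alone, so the induction step convolves a single Gamma law with the exponential
law. *)
Lemma iint_below_blocks (I : finType) n (c : 'I_n -> I) (b : I -> R) :
  iint (fun x : n.-tuple R => (below_blocks c b x * exp_weight x)%:E) =
  (\prod_(j : I) gamma_cdf (\sum_(i < n) (c i == j)) (b j))%:E.
Proof.
elim: n c b => [|n IHn] c b /=.
  rewrite /below_blocks /exp_weight big_ord0 mulr1; congr EFin.
  apply: eq_bigr => j _; rewrite !big_ord0 /gamma_cdf big_ord0 subr0.
  by case: ltP.
pose c' (i : 'I_n) := c (lift ord0 i).
pose b' r j := b j - (if c ord0 == j then r else 0).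
pose G j (t : R) := gamma_cdf (\sum_(i < n) (c' i == j)) t.
transitivity (\int[mu]_r ((\prod_(j | j != c ord0) G j (b j))%:E *
   (exponential_pdf 1 r * G (c ord0) (b (c ord0) - r))%:E))%E.
  apply: eq_integral => r _.
  transitivity (iint (fun x : n.-tuple R => (exponential_pdf 1 r)%:E *
      (below_blocks c' (b' r) x * exp_weight x)%:E))%E.
    apply: eq_iint => x; rewrite -EFinM; congr EFin.
    rewrite exp_weight_cons mulrCA; congr (_ * (_ * _)).
    apply: eq_bigr => j _; congr ((_ : bool)%:R).
    rewrite big_mkcond big_ord_recl -big_mkcond/= tnth0 /b' lerBrDl.
    by congr (_ + _ <= _); apply: eq_bigr => i _; rewrite tnthS.
  rewrite iintZl ?exponential_pdf_ge0//; last 2 first.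
  - apply/measurable_EFinP; apply: measurable_funM.
      exact: measurable_below_blocks.
    exact: measurable_exp_weight.
  - by move=> x; rewrite lee_fin mulr_ge0 ?below_blocks_ge0 ?exp_weight_ge0.
  rewrite IHn -!EFinM; congr EFin; rewrite mulrCA; congr (_ * _).
  rewrite (bigD1 (c ord0))//= mulrC /b' eqxx; congr (_ * _).
  by apply: eq_bigr => j /negPf jc; rewrite eq_sym jc subr0.
rewrite ge0_integralZl_EFin//.
- rewrite integral_exponential_gamma_cdf -EFinM; congr EFin.
  rewrite [in RHS](bigD1 (c ord0))//= mulrC; congr (_ * _).
    by rewrite [in RHS]big_ord_recl eqxx.
  apply: eq_bigr => j /negPf jc.
  by rewrite [in RHS]big_ord_recl eq_sym jc add0n.
- by move=> r _; rewrite lee_fin mulr_ge0 ?exponential_pdf_ge0 ?gamma_cdf_ge0.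
- apply/measurable_EFinP; apply: measurable_funM.
    exact: measurable_exponential_pdf.
  apply: measurableT_comp; first exact: measurable_gamma_cdf.
  exact: measurable_funB.
- by apply: prodr_ge0 => j _; exact: gamma_cdf_ge0.
Qed.

Definition exp_measure n (A : set (n.-tuple R)) : \bar R :=
  iint (fun x => (\1_A x * exp_weight x)%:E).

Section exp_measure_instance.
Variable n : nat.

Let exp_measure0 : exp_measure (set0 : set (n.-tuple R)) = 0%E.
Proof.
rewrite -(@iint0 R n); apply: eq_iint => x.
by rewrite indic0 mul0r.
Qed.

Let exp_measure_ge0 (A : set (n.-tuple R)) : (0 <= exp_measure A)%E.
Proof.
by apply: iint_ge0 => x; rewrite lee_fin mulr_ge0// exp_weight_ge0.
Qed.

Let exp_measure_sigma_additive : semi_sigma_additive (@exp_measure n).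
Proof.
move=> F mF tF mUF.
have -> : exp_measure (\bigcup_k F k) = (\sum_(k <oo) exp_measure (F k))%E.
  rewrite /exp_measure -iint_nneseries.
  - apply: eq_iint => x.
    have -> : ((\1_(\bigcup_k F k) x * exp_weight x)%:E =
               (exp_weight x)%:E * \d_x (\bigcup_k F k))%E.
      by rewrite /dirac -EFinM mulrC.
    rewrite measure_bigcup// -nneseriesZl//.
    rewrite (eq_eseriesl (Q := xpredT)) => [|k]; last by rewrite in_setT.
    by apply: eq_eseriesr => k _; rewrite /dirac -EFinM mulrC.
  - move=> k; apply/measurable_EFinP; apply: measurable_funM.
      exact: measurable_indic.
    exact: measurable_exp_weight.
  - by move=> k x; rewrite lee_fin mulr_ge0// exp_weight_ge0.
by apply: is_cvg_nneseries.
Qed.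

HB.instance Definition _ := isMeasure.Build _ _ _
  (@exp_measure n) exp_measure0 exp_measure_ge0 exp_measure_sigma_additive.

End exp_measure_instance.

(** * Measures on tuples are determined by lower boxes *)

Definition lower_box n (b : n.-tuple R) : set (n.-tuple R) :=
  [set x | forall i, tnth x i <= tnth b i].

Lemma lower_boxI n (b c : n.-tuple R) :
  lower_box b `&` lower_box c =
  lower_box [tuple Num.min (tnth b i) (tnth c i) | i < n].
Proof.
apply/seteqP; split => [x [xb xc] i|x xbc].
  by rewrite tnth_mktuple le_min xb xc.
by split=> i; have := xbc i; rewrite tnth_mktuple le_min => /andP[].
Qed.

Lemma measurable_lower_box n (b : n.-tuple R) : measurable (lower_box b).
Proof.
have -> : lower_box b = \bigcap_(i in [set: 'I_n])
    ((@tnth n R)^~ i @^-1` `]-oo, tnth b i]%classic).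
  apply/seteqP; split => [x xb i _|x xb i].
    by rewrite /= in_itv/= xb.
  by have := xb i Logic.I; rewrite /= in_itv.
apply: fin_bigcap_measurable => // i _; rewrite -[X in measurable X]setTI.
by apply: measurable_tnth => //; exact: measurable_itv.
Qed.

(** Lower boxes with all bounds equal to an integer exhaust the space. *)
Lemma le_archi_bound n (x : n.-tuple R) :
  exists k : nat, forall i, tnth x i <= k%:R.
Proof.
exists (Num.Def.archi_bound (\sum_(i < n) `|tnth x i|)) => i.
apply: (le_trans (ler_norm _)).
apply: (@le_trans _ _ (\sum_(i < n) `|tnth x i|)).
  by rewrite (bigD1 i)//= lerDl sumr_ge0.
by apply/ltW/archi_boundP; exact: sumr_ge0.
Qed.

(** The half-space {x_i <= r} is the increasing union of the boxes with i-th
bound r and all other bounds k. *)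
Lemma measurable_tuple_lower_box n :
  @measurable _ (n.-tuple R) = <<s range (@lower_box n) >>.
Proof.
apply/seteqP; split; last first.
  apply: smallest_sub; first exact: sigma_algebra_measurable.
  by move=> _ [b _ <-]; exact: measurable_lower_box.
apply: smallest_sub; first exact: smallest_sigma_algebra.
rewrite -bigcup_seq => A [i _].
have -> : preimage_set_system setT ((@tnth n R)^~ i) measurable =
   <<s preimage_set_system setT ((@tnth n R)^~ i) (@RGenOInfty.G R) >>.
  rewrite (g_sigma_preimageE (rT := R)).
  congr preimage_set_system; exact: RGenOInfty.measurableE.
apply: smallest_sub; first exact: smallest_sigma_algebra.
move=> _ [_ [r ->] <-]; rewrite setTI.
pose b (k : nat) : n.-tuple R := [tuple (if j == i then r else k%:R) | j < n].
have -> : (@tnth n R)^~ i @^-1` `]r, +oo[%classic =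
    ~` \bigcup_k lower_box (b k).
  apply/seteqP; split => [x /= | x /= xb].
    rewrite in_itv/= andbT => rx [k _ /(_ i)].
    by rewrite tnth_mktuple eqxx leNgt rx.
  rewrite in_itv/= andbT ltNge; apply/negP => xr; apply: xb.
  have [k kP] := le_archi_bound x.
  by exists k => // j; rewrite tnth_mktuple; case: eqP => [->|].
apply: sigma_algebraC; apply: sigma_algebra_bigcup => k.
by apply: sub_sigma_algebra; exists (b k).
Qed.

Lemma tuple_measure_unique n (m1 m2 : {measure set (n.-tuple R) -> \bar R}) :
  (forall b : n.-tuple R, m1 (lower_box b) = m2 (lower_box b)) ->
  (forall b : n.-tuple R, (m1 (lower_box b) < +oo)%E) ->
  forall A, measurable A -> m1 A = m2 A.
Proof.
move=> m12 m1oo A mA.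
apply: (measure_unique (range (@lower_box n))
  (fun k => lower_box [tuple k%:R | i < n])) => //.
- exact: measurable_tuple_lower_box.
- move=> _ _ [b _ <-] [c _ <-]; rewrite lower_boxI.
  by eexists.
- apply/seteqP; split => // x _; have [k kP] := le_archi_bound x.
  by exists k => // i; rewrite tnth_mktuple.
- by move=> _ [b _ <-]; exact: m12.
Qed.

End ExpMeasure.

(** * Arrival times of Poisson processes *)

Section Arrival.
Context {d : measure_display} {Omega : measurableType d} {R : realType}.
Variable P : probability Omega R.
Implicit Types N : R -> {RV P >-> nat}.

Lemma arrival_ge0 N a w : (0 <= arrival N a w)%E.
Proof. by apply/ereal_infP => _ [t [t0 _] <-]; rewrite lee_fin. Qed.

(** Right continuity makes a finite infimum in [arrival] attained: an
integer-valued right-continuous path that is below [a] at t stays constant, hence below [a],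
on some interval to the right of t. *)
Lemma arrival_le rate N a w t : poisson_process rate N -> 0 <= t ->
  (arrival N a w <= t%:E)%E = (a <= N t w)%N.
Proof.
move=> PN t0; apply/idP/idP => [|aN]; last first.
  by apply: ereal_inf_lbound; exists t.
apply: contraTT; rewrite -!ltNge -ltnNge => Na.
have nN : nbhs (N t w) [set N t w] by rewrite nbhs_principalE.
have := poisson_right_continuous PN t0 nN.
move=> /nbhs_ballP[e /= e0 eN].
apply: (@lt_le_trans _ _ (t + e)%:E); first by rewrite lte_fin ltrDl.
apply/ereal_infP => _ [s [s0 aNs] <-]; rewrite lee_fin leNgt.
apply/negP => ste; have [st|ts] := leP s t.
  have := leq_trans aNs (poisson_nondecreasing PN w s0 st).
  by rewrite leqNgt Na.
suff NsNt : N s w = N t w by move: aNs; rewrite NsNt leqNgt Na.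
apply: (eN s) => //; rewrite /ball/=.
by rewrite ltr0_norm; lra.
Qed.

Lemma measurable_preimage_RV (X : {RV P >-> nat}) (A : set nat) :
  measurable (X @^-1` A).
Proof. by rewrite -[X in measurable X]setTI; apply: measurable_funPT. Qed.

Lemma measurable_arrival rate N a : poisson_process rate N ->
  measurable_fun setT (arrival N a).
Proof.
move=> PN; apply: (measurability (@ErealGenOInfty.G R)).
  exact: ErealGenOInfty.measurableE.
move=> _ [_ [r ->] <-]; rewrite setTI.
have -> : arrival N a @^-1` `]r%:E, +oo[%classic =
    ~` [set w | (arrival N a w <= r%:E)%E].
  apply/seteqP; split => w /=; rewrite in_itv/= andbT ltNge; first by move/negP.
  by move=> ?; apply/negP.
apply: measurableC; have [r0|r0] := leP 0 r.
  under eq_fun do rewrite (arrival_le _ _ PN)//.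
  exact: (measurable_preimage_RV (N r) [set k | (a <= k)%N]).
rewrite (_ : [set _ | _] = set0)//; apply/seteqP; split => // w /= ar.
by have := le_trans (arrival_ge0 N a w) ar; rewrite lee_fin leNgt r0.
Qed.

(** The case t = 0 is separate since the law of the increments is only
prescribed on nondegenerate intervals. *)
Lemma poisson_tail rate N a t : 0 < rate -> poisson_process rate N -> 0 <= t ->
  P [set w | (a <= N t w)%N] = (gamma_cdf a (rate * t))%:E.
Proof.
move=> rate0 PN; rewrite le_eqVlt => /predU1P[<-|t0].
  rewrite mulr0 /gamma_cdf ltxx oppr0 expR0.
  case: a => [|a].
    rewrite big_ord0 subr0 (_ : [set _ | _] = setT) ?probability_setT//.
    exact/seteqP.
  rewrite big_ord_recl/= expr0 fact0 divr1 mulr1 big1 ?addr0 ?subrr.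
    rewrite (_ : [set _ | _] = set0) ?measure0//.
    by apply/seteqP; split => // w; rewrite /= (poisson_start PN).
  by move=> k _; rewrite /bump/= expr0n/= mul0r mul0r.
rewrite /gamma_cdf ltNge mulr_ge0/= ?ltW//.
elim: a => [|a IHa].
  rewrite big_ord0 subr0 (_ : [set _ | _] = setT) ?probability_setT//.
  exact/seteqP.
rewrite big_ord_recr/= opprD addrA EFinB -IHa.
have -> : [set w | (a <= N t w)%N] =
    [set w | (a < N t w)%N] `|` increment N 0 t @^-1` [set a].
  rewrite /increment; apply/seteqP.
  split => w /=; rewrite (poisson_start PN) subn0.
    by rewrite leq_eqVlt => /predU1P[->|]; [right|left].
  by case=> [/ltnW|->].
have incE : increment N 0 t @^-1` [set a] = N t @^-1` [set a].
  by apply/seteqP; split => w /=; rewrite /increment (poisson_start PN) subn0.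
rewrite measureU//; last first.
- apply/seteqP; split => // w []/=; rewrite /increment (poisson_start PN) subn0.
  by move=> /[swap] ->; rewrite ltnn.
- by rewrite incE; exact: measurable_preimage_RV.
- exact: (measurable_preimage_RV (N t) [set k | (a < k)%N]).
rewrite [X in (_ + X - _)%E](poisson_increment_law PN a (lexx 0) t0).
rewrite subr0 /poisson_pmf mulr_gt0//.
by rewrite addeK.
Qed.

(** Each event is {N_i (b_i) >= a_i}, which belongs to the sigma-algebra of the
i-th process. *)
Lemma arrivals_joint_law (I : finType) (rate : I -> R)
    (N : I -> R -> {RV P >-> nat}) (a : I -> nat) (b : I -> R) :
  (forall i, 0 < rate i) -> (forall i, poisson_process (rate i) (N i)) ->
  independent_processes N ->
  P [set w | forall i, (arrival (N i) (a i) w <= (b i)%:E)%E] =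
  (\prod_i gamma_cdf (a i) (rate i * b i))%:E.
Proof.
move=> rate0 PN indepN.
have [b0|] := boolP [forall i, 0 <= b i]; last first.
  rewrite negb_forall => /existsP[i]; rewrite -ltNge => bi0.
  rewrite (bigD1 i)//= /gamma_cdf (pmulr_rlt0 _ (rate0 i)) bi0 mul0r.
  rewrite (_ : [set _ | _] = set0) ?measure0//; apply/seteqP; split => // w.
  move=> /(_ i) /(le_trans (arrival_ge0 _ _ _)).
  by rewrite lee_fin leNgt bi0.
pose E i := N i (b i) @^-1` [set k | (a i <= k)%N].
have mE i : measurable (E i) by exact: measurable_preimage_RV.
have -> : [set w | forall i, (arrival (N i) (a i) w <= (b i)%:E)%E] =
    \bigcap_(i in [set` [set: I]%SET]) E i.
  apply/seteqP; split => w /= h i => [_|]; have := h i;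
    rewrite (arrival_le _ _ (PN i)) ?(forallP b0)//.
  by apply; rewrite /= finset.in_setT.
rewrite -[LHS]fineK ?fin_num_measure//; last first.
  by apply: fin_bigcap_measurable => // ; exact: finite_finset.
congr EFin; rewrite indepN.
  apply: eq_big => [i|i _]; first by rewrite finset.in_setT.
  by rewrite (poisson_tail _ (rate0 i) (PN i) (forallP b0 i)).
move=> i _; apply: sub_sigma_algebra; exists (b i); first exact: (forallP b0).
by exists [set k | (a i <= k)%N] => //; rewrite setTI.
Qed.

End Arrival.

(** * Arrival times compared with exponential block sums *)

Section ExpModel.
Context {R : realType}.

Lemma exp_measure_setT n : exp_measure [set: n.-tuple R] = 1%E.
Proof.
rewrite /exp_measure; under eq_iint do rewrite indicT mul1r.
elim: n => [|n IHn] /=; first by rewrite /exp_weight big_ord0.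
rewrite -[RHS](@integral_exponential_pdf R 1 ltr01).
apply: eq_integral => r _.
under eq_iint do rewrite exp_weight_cons EFinM.
rewrite iintZl ?exponential_pdf_ge0// ?IHn ?mule1//.
- by apply/measurable_EFinP; exact: measurable_exp_weight.
- by move=> x; rewrite lee_fin exp_weight_ge0.
Qed.

Definition block_sums n m (c : 'I_n -> 'I_m) (rho : 'I_m -> R)
    (x : n.-tuple R) : m.-tuple R :=
  [tuple (\sum_(i < n | c i == j) tnth x i) / rho j | j < m].

Lemma measurable_block_sums n m (c : 'I_n -> 'I_m) (rho : 'I_m -> R) :
  measurable_fun setT (block_sums c rho).
Proof.
apply/measurable_fun_tnthP => j.
rewrite (_ : _ \o _ =
    fun x => (\sum_(i < n) if c i == j then tnth x i else 0) / rho j);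
    last first.
  by apply/funext => x /=; rewrite tnth_mktuple big_mkcond.
apply: measurable_funM => //; apply: measurable_sum => i.
by case: (c i == j) => //; exact: measurable_tnth.
Qed.

Lemma exp_measure_block_sums_lower_box n m (c : 'I_n -> 'I_m)
    (rho : 'I_m -> R) (b : m.-tuple R) : (forall j, 0 < rho j) ->
  exp_measure (block_sums c rho @^-1` lower_box b) =
  (\prod_(j < m) gamma_cdf (\sum_(i < n) (c i == j)) (rho j * tnth b j))%:E.
Proof.
move=> rho0; rewrite -iint_below_blocks; apply: eq_iint => x.
congr (_ * _)%:E; rewrite indicE /below_blocks.
have boxE j : (tnth (block_sums c rho x) j <= tnth b j) =
    (\sum_(i < n | c i == j) tnth x i <= rho j * tnth b j).
  by rewrite tnth_mktuple ler_pdivrMr// mulrC.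
have [/set_mem xb|/negP xb] := boolP (x \in _).
  by rewrite big1// => j _; rewrite -boxE; have /= -> := xb j.
have [j xj] : exists j, ~~ (tnth (block_sums c rho x) j <= tnth b j).
  by apply/existsP; rewrite -negb_forall; apply/forallP => h; exact/xb/mem_set.
by rewrite (bigD1 j)//= -boxE (negbTE xj) mul0r.
Qed.

End ExpModel.

Section ArrivalsOrder.
Context {d : measure_display} {Omega : measurableType d} {R : realType}.
Variable P : probability Omega R.

Definition chain m : set (m.-tuple R) :=
  [set y | forall i j : 'I_m, j = i.+1 :> nat -> tnth y i <= tnth y j].

Lemma measurable_chain m : measurable (@chain m).
Proof.
have -> : @chain m = \bigcap_(i in [set: 'I_m])
    \bigcap_(j in [set j : 'I_m | j = i.+1 :> nat])
      [set y | tnth y i <= tnth y j].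
  apply/seteqP; split => [y yc i _ j ij|y yc i j ij]; first exact: yc.
  exact: yc.
apply: fin_bigcap_measurable => // i _; apply: fin_bigcap_measurable => // j _.
rewrite -[X in measurable X]setTI.
by apply: measurable_fun_le => //; exact: measurable_tnth.
Qed.

(** The two vectors have the same law on lower boxes. Arrival times may be
infinite, so the law of the arrival vector is taken on the event D that all of
them are finite. It is a priori a subprobability, but it agrees on lower boxes
with a probability, so that D has probability one. *)
Lemma prob_arrivals_ordered n m (c : 'I_n -> 'I_m) (rho : 'I_m -> R)
    (a : 'I_m -> nat) (N : 'I_m -> R -> {RV P >-> nat}) :
  (forall j, a j = \sum_(i < n) (c i == j))%N ->
  (forall j, 0 < rho j) -> (forall j, poisson_process (rho j) (N j)) ->
  independent_processes N ->
  P [set w | forall i j : 'I_m, j = i.+1 :> nat ->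
      (arrival (N i) (a i) w <= arrival (N j) (a j) w)%E] =
  exp_measure (block_sums c rho @^-1` @chain m).
Proof.
move=> aE rho0 PN indepN.
pose t j := arrival (N j) (a j).
have mt j : measurable_fun setT (t j) by exact: measurable_arrival (PN j).
pose D := [set w | forall j, (t j w < +oo)%E].
have mD : measurable D.
  have -> : D = \bigcap_(j in [set: 'I_m]) [set w | (t j w < +oo)%E].
    by apply/seteqP; split => [w Dw j _|w Dw j]; exact: Dw.
  apply: fin_bigcap_measurable => // j _; rewrite -[X in measurable X]setTI.
  exact: emeasurable_fun_infty_o.
have tfin w j : D w -> (fine (t j w))%:E = t j w.
  by move=> Dw; rewrite fineK// ge0_fin_numE; [exact: Dw|exact: arrival_ge0].
pose tau w := [tuple fine (t j w) | j < m].
have mtau : measurable_fun setT tau.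
  apply/measurable_fun_tnthP => j.
  rewrite (_ : _ \o _ = fine \o t j); last first.
    by apply/funext => w /=; rewrite tnth_mktuple.
  by apply: measurableT_comp => //; exact: fine_measurable.
pose m1 := image_measure (mrestr P mD) mtau.
pose m2 := image_measure (@exp_measure R n) (measurable_block_sums c rho).
have m1E A : m1 A = P (tau @^-1` A `&` D) by [].
have m1_box b : m1 (lower_box b) =
    (\prod_j gamma_cdf (a j) (rho j * tnth b j))%:E.
  rewrite m1E -(arrivals_joint_law _ _ rho0 PN indepN); congr (P _).
  apply/seteqP; split => w.
    move=> [/= wb Dw] j; have := wb j.
    by rewrite tnth_mktuple -lee_fin tfin.
  move=> wb; have Dw : D w by move=> j; exact: le_lt_trans (wb j) (ltry _).
  by split => // j; rewrite tnth_mktuple -lee_fin tfin//; exact: wb.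
have m12 A : measurable A -> m1 A = m2 A.
  apply: (@tuple_measure_unique R m m1 m2) => b.
    apply: (etrans (m1_box b)); apply: esym.
    apply: (etrans (exp_measure_block_sums_lower_box _ _ rho0)).
    by congr EFin; apply: eq_bigr => j _; rewrite aE.
  by have := ltry (\prod_j gamma_cdf (a j) (rho j * tnth b j)); rewrite -m1_box.
have PD : P D = 1%E.
  have := m12 setT measurableT.
  by rewrite m1E setTI => ->; exact: exp_measure_setT.
set A := (X in P X).
have AE : A `&` D = tau @^-1` @chain m `&` D.
  apply/seteqP; split => w [Aw Dw]; split => // i j ij.
    by rewrite !tnth_mktuple -lee_fin !tfin//; exact: Aw.
  have := Aw i j ij; by rewrite /tau !tnth_mktuple -lee_fin !tfin.
have mA : measurable A.
  have -> : A = \bigcap_(i in [set: 'I_m])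
      \bigcap_(j in [set j : 'I_m | j = i.+1 :> nat])
      [set w | (t i w <= t j w)%E].
    by apply/seteqP; split => [w wc i _ j ij|w wc i j ij]; exact: wc.
  apply: fin_bigcap_measurable => // i _.
  apply: fin_bigcap_measurable => // j _.
  rewrite -[X in measurable X]setTI; exact: measurable_lee.
transitivity (P (A `&` D)).
  have mDC := measurableC mD.
  have PDC : P (~` D) = 0%E by rewrite probability_setC// PD subee.
  apply/eqP; rewrite eq_le; apply/andP; split; last first.
    by apply: le_measure; rewrite ?inE//; exact: measurableI.
  rewrite -[leRHS]adde0 -PDC; apply: le_trans (measureU2 _ _ _) => //.
  - apply: le_measure; rewrite ?inE//;
      first by apply: measurableU => //; exact: measurableI.
    by move=> w Aw; have [Dw|Dw] := pselect (D w); [left|right].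
  - exact: measurableI.
rewrite AE -m1E m12//; exact: measurable_chain.
Qed.

End ArrivalsOrder.

(** * Cones, relative volumes and flags *)

Section ConeRatio.
Context {R : realType}.

Definition orthant n : set (n.-tuple R) := [set x | forall i, 0 <= tnth x i].

Lemma measurable_orthant n : measurable (@orthant n).
Proof.
have -> : @orthant n =
    \bigcap_(i in [set: 'I_n]) [set x : n.-tuple R | 0 <= tnth x i].
  by apply/seteqP; split => [x x0 i _|x x0 i]; exact: x0.
apply: fin_bigcap_measurable => // i _; rewrite -[X in measurable X]setTI.
by apply: measurable_fun_le => //; exact: measurable_tnth.
Qed.

Lemma exp_measure_orthant n (A : set (n.-tuple R)) :
  exp_measure (A `&` @orthant n) = exp_measure A.
Proof.
apply: eq_iint => x; congr EFin.
have [x0|/existsNP[i /negP]] := pselect (orthant x).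
  by rewrite !indicE in_setI (mem_set x0) andbT.
rewrite -ltNge => xi0; rewrite /exp_weight (bigD1 i)//=.
by rewrite lt0_exponential_pdf// mul0r !mulr0.
Qed.

(** [iint_exp_cone] applied to the cone and to the whole orthant gives the
probabilities P (A) = K * vol and 1 = K * vol' with the same K. The second
identity also shows that K and vol' are finite and nonzero. *)
Lemma exp_measure_cone n (A : set (n.+1.-tuple R)) : measurable A ->
  (forall c x, 0 < c -> A x -> A (scale_tuple c x)) ->
  exp_measure A =
  (fine (lebesgue_measure_n
     [set y : n.-tuple R | (A `&` @orthant n.+1) (complete_sum y 1)]) /
   fine (lebesgue_measure_n
     [set y : n.-tuple R | orthant (complete_sum y 1)]))%:E.
Proof.
move=> mA Ac.
set vA := lebesgue_measure_n [set y : n.-tuple R | (A `&` _) _].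
set vT := lebesgue_measure_n [set y : n.-tuple R | orthant _].
pose K : \bar R := gamma_mass n.
have orthant_scale c (x : n.+1.-tuple R) :
    0 < c -> orthant x -> orthant (scale_tuple c x).
  by move=> c0 x0 i; rewrite tnth_map mulr_ge0// ltW.
have EA : exp_measure A = (K * vA)%E.
  rewrite -exp_measure_orthant; apply: iint_exp_cone.
  - by apply: measurableI => //; exact: measurable_orthant.
  - by move=> x [].
  - by move=> c x c0 [Ax x0]; split; [exact: Ac|exact: orthant_scale].
have E1 : 1%E = (K * vT)%E.
  rewrite -(@exp_measure_setT R n.+1) -exp_measure_orthant setTI.
  apply: iint_exp_cone => //; exact: measurable_orthant.
have A1 : (exp_measure A <= 1)%E.
  by rewrite -(@exp_measure_setT R n.+1); apply: le_measure; rewrite ?inE.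
have K0 : (0 <= K)%E.
  apply: integral_ge0 => s /=; rewrite in_itv/= andbT => s0.
  by rewrite lee_fin mulr_ge0 ?expR_ge0 ?exprn_ge0// ltW.
have vA0 : (0 <= vA)%E.
  by rewrite /vA lebesgue_measure_nE; apply: iint_ge0 => x; rewrite lee_fin.
have vT0 : (0 <= vT)%E.
  by rewrite /vT lebesgue_measure_nE; apply: iint_ge0 => x; rewrite lee_fin.
have K_gt0 : (0 < K)%E.
  rewrite lt_neqAle K0 andbT; apply/eqP => K0'.
  by move: E1; rewrite -K0' mul0e => -[] /eqP; rewrite oner_eq0.
have vT_gt0 : (0 < vT)%E.
  rewrite lt_neqAle vT0 andbT; apply/eqP => v0'.
  by move: E1; rewrite -v0' mule0 => -[] /eqP; rewrite oner_eq0.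
have KE : (fine K)%:E = K.
  rewrite fineK// ge0_fin_numE// ltey; apply/eqP => KE.
  by move: E1; rewrite KE gt0_mulye.
have vTE : (fine vT)%:E = vT.
  rewrite fineK// ge0_fin_numE// ltey; apply/eqP => vE.
  by move: E1; rewrite vE gt0_muley.
have vAE : (fine vA)%:E = vA.
  rewrite fineK// ge0_fin_numE// ltey; apply/eqP => vE.
  by move: A1; rewrite EA vE gt0_muley.
move: E1; rewrite EA -vAE -KE -vTE /= -!EFinM => -[] E1; congr EFin.
have vT_neq0 : fine vT != 0.
  by apply/eqP => v0; move: vT_gt0; rewrite -vTE v0 ltxx.
by apply: (mulIf vT_neq0); rewrite divfK// mulrAC -E1 mul1r.
Qed.

End ConeRatio.

Section Flag.
Context {R : realType} {V : finType} {m : nat}.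
Variable F : 'I_m.+1 -> {set V}.
Hypothesis flagF : is_flag F.

(** At Phi (r, theta) the sum over the block F j is r j, whence the direct
inclusion. Conversely r is read off the block sums and theta is obtained by
normalising on each block. *)
Lemma image_Phi (rho : 'I_m.+1 -> R) :
  [set Phi F r theta | r in R_rho rho & theta in Theta F] =
  [set l | simplex l /\ forall i j : 'I_m.+1, j = i.+1 :> nat ->
    (\sum_(v in F i) l v) / rho i <= (\sum_(v in F j) l v) / rho j].
Proof.
have [Fn0 Fu] := flagF.
have FE v j k : v \in F j -> v \in F k -> j = k.
  by move=> vj vk; have [l [_ lu]] := Fu v; rewrite -(lu _ vj) -(lu _ vk).
have sumV (l : V -> R) : \sum_v l v = \sum_j \sum_(v in F j) l v.
  rewrite (exchange_big_dep predT)//=; apply: eq_bigr => v _.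
  have [j [vj _]] := Fu v; rewrite (bigD1 j)//= big1 ?addr0// => k /andP[vk].
  by rewrite (FE _ _ _ vk vj) eqxx.
have PhiE (r : 'I_m.+1 -> R) th v j : v \in F j -> Phi F r th v = r j * th v.
  move=> vj; rewrite /Phi (bigD1 j)//= big1 ?addr0// => k /andP[vk].
  by rewrite (FE _ _ _ vk vj) eqxx.
have sumPhi (r : 'I_m.+1 -> R) th j : Theta F th ->
    \sum_(v in F j) Phi F r th v = r j.
  move=> [_ th1]; rewrite -[RHS]mulr1 -(th1 j) mulr_sumr.
  by apply: eq_bigr => v vj; exact: PhiE.
apply/seteqP; split => l.
  move=> [r [[r0 r1] rc] [th thT <-]].
  split; last by move=> i j ij; rewrite !sumPhi//; exact: rc.
  split => [v|].
    by apply: sumr_ge0 => j _; rewrite mulr_ge0//; exact: thT.1.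
  by rewrite sumV -[RHS]r1; apply: eq_bigr => j _; exact: sumPhi.
move=> [[l0 l1] lc].
pose r j := \sum_(v in F j) l v.
(* On a block where l vanishes theta is arbitrary; the uniform weights, which
   need the block to be nonempty, are chosen. *)
pose th v := \sum_(j | v \in F j)
  (if r j == 0 then #|F j|%:R^-1 else l v / r j).
have thE v j : v \in F j -> th v = if r j == 0 then #|F j|%:R^-1 else l v / r j.
  move=> vj; rewrite /th (bigD1 j)//= big1 ?addr0// => k /andP[vk].
  by rewrite (FE _ _ _ vk vj) eqxx.
exists r; first by split => //; split => [j|]; [exact: sumr_ge0|rewrite -sumV].
have r_ge0 j : 0 <= r j by exact: sumr_ge0.
exists th.
  split => [v|j].
    apply: sumr_ge0 => j _; case: ifP => _; first by rewrite invr_ge0.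
    by rewrite divr_ge0.
  have [rj|rj] := eqVneq (r j) 0; last first.
    under eq_bigr => v vj do rewrite (thE _ _ vj) (negbTE rj).
    by rewrite -mulr_suml divff.
  under eq_bigr => v vj do rewrite (thE _ _ vj) rj eqxx.
  rewrite sumr_const -[LHS]mulr_natr mulVf// pnatr_eq0 -lt0n.
  by have [v vj] := Fn0 j; apply/card_gt0P; exists v.
apply/funext => v; have [j [vj _]] := Fu v.
rewrite (PhiE _ _ _ _ vj) (thE _ _ vj); case: ifPn => [/eqP rj|rj].
  rewrite rj mul0r; apply/esym/eqP.
  by have /psumr_eq0P -> // : \sum_(v in F j) l v = 0 by exact: rj.
by rewrite mulrC divfK.
Qed.

End Flag.

Section RelativeVolume.
Context {R : realType} {V : finType} {m : nat}.
Variable F : 'I_m.+1 -> {set V}.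
Hypothesis flagF : is_flag F.
Hypothesis V_gt0 : (0 < #|V|)%N.

Let vertex (i : 'I_(#|V|.-1.+1)) : V := enum_val (cast_ord (prednK V_gt0) i).
Let coord (v : V) : 'I_(#|V|.-1.+1) :=
  cast_ord (esym (prednK V_gt0)) (enum_rank v).

Let vertexK : cancel vertex coord.
Proof. by move=> i; rewrite /coord /vertex enum_valK cast_ordK. Qed.

Let coordK : cancel coord vertex.
Proof. by move=> v; rewrite /coord /vertex cast_ordKV enum_rankK. Qed.

Let hyperplane_chartE (x : #|V|.-1.-tuple R) v :
  hyperplane_chart x v = tnth (complete_sum x 1) (coord v).
Proof.
rewrite (tnth_nth 0) /= nth_rcons size_tuple /hyperplane_chart big_tuple.
have [lt|le] := ltnP; first by apply: set_nth_default; rewrite size_tuple.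
rewrite nth_default ?size_tuple// ifT// eqn_leq le andbT.
by rewrite -ltnS prednK// ltn_ord.
Qed.

Let block (i : 'I_(#|V|.-1.+1)) : 'I_m.+1 :=
  odflt ord0 [pick j | vertex i \in F j].

Let blockE i j : (block i == j) = (vertex i \in F j).
Proof.
rewrite /block; have [k [ik uk]] := flagF.2 (vertex i).
case: pickP => [l il|]; last by move=> /(_ k); rewrite ik.
rewrite -(uk _ il)/=; apply/eqP/idP => [<-//|]; exact: uk.
Qed.


Let sum_block (z : 'I_(#|V|.-1.+1) -> R) j :
  \sum_(v in F j) z (coord v) = \sum_(i | block i == j) z i.
Proof.
rewrite (reindex vertex)/=; last by apply: onW_bij; exists coord.
by apply: eq_big => [i|i _]; rewrite ?blockE ?vertexK.
Qed.

Let chart_simplex (x : #|V|.-1.-tuple R) :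
  simplex (hyperplane_chart x : V -> R) <-> orthant (complete_sum x 1).
Proof.
split => [[x0 _] i|x0]; first by rewrite -(vertexK i) -hyperplane_chartE.
split => [v|]; first by rewrite hyperplane_chartE.
rewrite -[RHS](sum_complete_sum x); under eq_bigr do rewrite hyperplane_chartE.
rewrite (reindex vertex)/=; last by apply: onW_bij; exists coord.
by apply: eq_bigr => i _; rewrite vertexK.
Qed.

(** The chart of the hyperplane singles out the last element in the enumeration
of V, which has nothing to do with the flag. The elements of V are therefore
numbered by that enumeration, and the flag is remembered as the map [c] from
indices to blocks. *)
Lemma p_flag_exp_measure (rho : 'I_m.+1 -> R) : (forall j, 0 < rho j) ->
  exists2 c : 'I_(#|V|.-1.+1) -> 'I_m.+1,
    forall j, #|F j| = (\sum_i (c i == j))%N &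
    exp_measure (block_sums c rho @^-1` @chain R m.+1) = (p_flag F rho)%:E.
Proof.
move=> rho0; exists block => [j|].
  rewrite -sum1_card big_mkcond (reindex vertex)/=; last first.
    by apply: onW_bij; exists coord.
  by apply: eq_bigr => i _; rewrite blockE; case: ifP.
have s0 : 0 < \sum_j rho j.
  by rewrite (bigD1 ord0)//= ltr_pwDl// sumr_ge0// => j _; exact: ltW.
rewrite exp_measure_cone; last 2 first.
- rewrite -[X in measurable X]setTI; apply: measurable_block_sums => //.
  exact: measurable_chain.
- move=> c x c0 xc i j ij; have := xc i j ij; rewrite !tnth_mktuple.
  have scale_sum k : \sum_(i | block i == k) tnth (scale_tuple c x) i =
      c * \sum_(i | block i == k) tnth x i.
    by rewrite mulr_sumr; apply: eq_bigr => l _; rewrite tnth_map.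
  by rewrite !scale_sum -!mulrA ler_pM2l.
have chart_chain (x : #|V|.-1.-tuple R) i j :
    (tnth (block_sums block rho (complete_sum x 1)) i <=
     tnth (block_sums block rho (complete_sum x 1)) j) =
    ((\sum_(v in F i) hyperplane_chart x v) / (rho i / \sum_k rho k) <=
     (\sum_(v in F j) hyperplane_chart x v) / (rho j / \sum_k rho k)).
  under eq_bigr do rewrite hyperplane_chartE.
  under [X in _ = (_ <= X / _)]eq_bigr do rewrite hyperplane_chartE.
  rewrite !(sum_block (tnth (complete_sum x 1))) !invf_div !mulrA.
  rewrite !(mulrAC _ (\sum_k rho k)) ler_pM2r//.
  by rewrite !tnth_mktuple.
congr EFin; rewrite /p_flag /p_flag_simplex image_Phi//.
rewrite /relative_volume /hyperplane_volume.
set s := Num.sqrt _.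
have s_gt0 : 0 < s by rewrite sqrtr_gt0 ltr0n.
have fineZ (x : \bar R) : fine (s%:E * x)%E = s * fine x.
  case: x => [r| |] //=; first by rewrite gt0_muley ?lte_fin// mulr0.
  by rewrite gt0_muleNy ?lte_fin// mulr0.
(* The Gram factor of the chart cancels in the quotient of volumes. *)
rewrite !fineZ -mulf_div divff ?gt_eqF// mul1r.
congr (fine _ / fine _); congr lebesgue_measure_n; last first.
  by apply/seteqP; split => x /=; rewrite chart_simplex.
apply/seteqP; split => x /=.
  move=> [xc /chart_simplex xs]; split => // i j ij.
  by rewrite -chart_chain; exact: xc.
move=> [/chart_simplex xs xc]; split => // i j ij.
by rewrite chart_chain; exact: xc.
Qed.
End RelativeVolume.

Unset Implicit Arguments.

Theorem proposition2p33 (R : realType) (V : finType) (n k : nat)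
    (cardV : #|V| = n.+1) (le_k_n : (k <= n)%N)
    (F : 'I_(n - k).+1 -> {set V}) (flagF : is_flag F)
    (rho : 'I_(n - k).+1 -> R) (rho_gt0 : forall j, 0 < rho j)
    (d : measure_display) (Omega : measurableType d)
    (P : probability Omega R)
    (N : 'I_(n - k).+1 -> R -> {RV P >-> nat})
    (poissonN : forall j, poisson_process (rho j) (N j))
    (indepN : independent_processes N) :
  P [set w | forall i j : 'I_(n - k).+1, j = i.+1 :> nat ->
               (arrival (N i) #|F i| w <= arrival (N j) #|F j| w)%E]
  = (p_flag F rho)%:E.
Proof.
have V_gt0 : (0 < #|V|)%N by rewrite cardV.
have [c Fc <-] := p_flag_exp_measure flagF V_gt0 rho_gt0.
exact: prob_arrivals_ordered.
Qed.
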